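(* Let $k$ be a field of characteristic zero. Any $2$-step solvable filiform nilpotent Lie algebra $\mathfrak{f}_n$ over $k$ (of dimension $n$) admits a complete LR-structure.
   Context: An LR-structure on a Lie algebra $\mathfrak{g}$ over $k$ is a bilinear product $\mathfrak{g}\times\mathfrak{g}\to\mathfrak{g}$, $(x,y)\mapsto x\cdot y$, satisfying for all $x,y,z\in\mathfrak{g}$: $x\cdot(y\cdot z)=y\cdot(x\cdot z)$, $(x\cdot y)\cdot z=(x\cdot z)\cdot y$, and $[x,y]=x\cdot y-y\cdot x$. It is complete if all left multiplications $L(x)\colon y\mapsto x\cdot y$ are nilpotent. A Lie algebra $\mathfrak{g}$ is $2$-step solvable if $[[\mathfrak{g},\mathfrak{g}],[\mathfrak{g},\mathfrak{g}]]=0$. A filiform nilpotent Lie algebra of dimension $n$ is a nilpotent Lie algebra of dimension $n$ and of (maximal) nilpotency class $n-1$. *)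

(* Defs.v *)
From HB Require Import structures.
From mathcomp Require Import all_boot all_order all_algebra.

Set Implicit Arguments.
Unset Strict Implicit.
Unset Printing Implicit Defensive.

Import GRing.Theory.
Local Open Scope ring_scope.

Definition is_lie_bracket (k : fieldType) (g : lmodType k)
    (br : {bilinear g -> g -> g}) : Prop :=
  (forall x, br x x = 0) /\
  (forall x y z, br x (br y z) + br y (br z x) + br z (br x y) = 0).

Definition is_LR_structure (k : fieldType) (g : lmodType k)
    (br mul : {bilinear g -> g -> g}) : Prop :=
  [/\ forall x y z, mul x (mul y z) = mul y (mul x z),
      forall x y z, mul (mul x y) z = mul (mul x z) y &
      forall x y, br x y = mul x y - mul y x].

Definition nilpotent_endo (V : zmodType) (f : V -> V) : Prop :=
  exists m, forall y, iter m f y = 0.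

Definition is_complete (k : fieldType) (g : lmodType k)
    (mul : {bilinear g -> g -> g}) : Prop :=
  forall x, nilpotent_endo (mul x).

(* By bilinearity, brackets of basis vectors span the subspace generated by
   all brackets of an element of U with an element of W; see [brv_subP]. *)
Definition brv (k : fieldType) (g : vectType k) (br : {bilinear g -> g -> g})
    (U W : {vspace g}) : {vspace g} :=
  <<[seq br u w | u <- vbasis U, w <- vbasis W]>>%VS.

Lemma brv_subP (k : fieldType) (g : vectType k) (br : {bilinear g -> g -> g})
    (U W X : {vspace g}) :
  (forall u w, u \in U -> w \in W -> br u w \in X) <-> (brv br U W <= X)%VS.
Proof.
split=> [brX | brX u w uU wW].
  apply/span_subvP => _ /allpairsP[[u w] [/= uU wW ->]].
  by apply: brX; apply: vbasis_mem.
apply: (subvP brX); rewrite (coord_vbasis uU) (coord_vbasis wW).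
rewrite linear_sumlz; apply: memv_suml => i _; rewrite linear_sumr.
apply: memv_suml => j _; rewrite linearZl_LR linearZr_LR !memvZ //.
by apply: memv_span; apply: allpairs_f; apply: mem_nth; rewrite size_tuple.
Qed.

(* Indexing starts at 0: [lower_central br i] is the (i+1)-st term of the lower
   central series, so that the class is the least i at which it vanishes. *)
Fixpoint lower_central (k : fieldType) (g : vectType k)
    (br : {bilinear g -> g -> g}) (i : nat) : {vspace g} :=
  if i is j.+1 then brv br fullv (lower_central br j) else fullv.

Definition nilpotent_of_class (k : fieldType) (g : vectType k)
    (br : {bilinear g -> g -> g}) (c : nat) : Prop :=
  lower_central br c = 0%VS /\
  forall i, (i < c)%N -> lower_central br i <> 0%VS.

(* [0 < n] rules out the zero algebra, for which [n.-1] would be truncated. *)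
Definition is_filiform (k : fieldType) (g : vectType k)
    (br : {bilinear g -> g -> g}) (n : nat) : Prop :=
  [/\ (0 < n)%N, \dim {:g} = n & nilpotent_of_class br n.-1].

Definition two_step_solvable (k : fieldType) (g : vectType k)
    (br : {bilinear g -> g -> g}) : Prop :=
  brv br (brv br fullv fullv) (brv br fullv fullv) = 0%VS.

(* Main.v *)
Require Import Defs.
From HB Require Import structures.
From mathcomp Require Import all_boot all_order all_algebra.
From mathcomp Require Import zify.

Set Implicit Arguments.
Unset Strict Implicit.
Unset Printing Implicit Defensive.

Import GRing.Theory.
Local Open Scope ring_scope.

(** Let g = C_0 and C_(i+1) = [g, C_i] be the lower central series, so that
    C_1 = [g, g] is abelian.  If C_1 = 0 the zero product will do; otherwise
    C_1 has codimension two.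

    The construction.  Suppose e1, e2 span a complement of C_1, with coordinate
    functionals a, b vanishing on C_1, write c = [e1, e2], and let
    y' = y - a(y) e1 - b(y) e2 be the C_1-component of y.  Let e1 and e2 act on the span of e2 and C_1 as
    ad e1 and ad e2, except that e2.e2 is replaced by an element z of C_1, and
    let both kill e1 and C_1 act by 0:
      x.y = [x, y'] + a(x) b(y) c + b(x) b(y) z.
    The skew part of this product is the bracket, because C_1 is abelian.
    All products lie in C_1 and C_1 acts by zero, so (x.y).w = 0 and the right
    multiplications commute.  The Jacobi identity makes the maps ad x commute
    on C_1, so the only condition for the left multiplications to commute is
    that e1.(e2.e2) = e2.(e1.e2), that is [e1, z] = [e2, c] ([LR_product]).
    Finally L(x) maps g into C_1, where it is ad x, hence it is nilpotent.

    Existence of z.  It is enough to find e1 with C_2 = [e1, C_1], as [e2, c]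
    lies in C_2.  In a filiform algebra C_2 / C_3 has dimension at most one,
    so if C_2 is nonzero, some e1 and v in C_1 give [e1, v] spanning C_2 modulo
    C_3.  As the maps ad x commute on C_1, [e1, C_1] is an ideal, and since it
    fills C_2 modulo C_3, a Nakayama argument along the lower central series
    shows that it contains C_2 ([lower_central_nakayama],
    [filiform_generator]).  Such an e1 is outside C_1, since [e1, C_1] is
    nonzero; if C_2 = 0, any e1 outside C_1 serves.  As C_1 has codimension
    two, a vector e2 completes the complement. *)

(** * Linear algebra *)

Lemma bilinear_of (k : fieldType) (g : lmodType k) (m : g -> g -> g) :
  bilinear_for *:%R *:%R m ->
  exists mul : {bilinear g -> g -> g}, forall x y, mul x y = m x y.
Proof.
move=> m_bil.
pose mB := bilinear_isBilinear.Build k g g g *:%R *:%R m m_bil.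
pose mul : {bilinear g -> g -> g} := HB.pack m mB.
by exists mul.
Qed.

Lemma cap_line_notin (k : fieldType) (g : vectType k) (U : {vspace g}) (v : g) :
  v \notin U -> (<[v]> :&: U = 0)%VS.
Proof.
move=> vU; apply/eqP; rewrite -subv0; apply/subvP=> w.
rewrite memv_cap => /andP[/vlineP[s ws] wU]; rewrite memv0.
have [s0|s0] := eqVneq s 0; first by rewrite ws s0 scale0r.
by case/negP: vU; rewrite -(scale1r v) -(mulVf s0) -scalerA -ws memvZ.
Qed.

Lemma dim_add_line (k : fieldType) (g : vectType k) (U : {vspace g}) (v : g) :
  v \notin U -> \dim (U + <[v]>) = (\dim U).+1.
Proof.
move=> vU; have v0 : v != 0 by apply: contraNneq vU => ->; rewrite mem0v.
by rewrite dimv_disjoint_sum ?dim_vline ?v0 ?addn1 // capvC cap_line_notin.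
Qed.

Lemma separating_functional (k : fieldType) (g : vectType k)
    (U : {vspace g}) (e : g) :
  e \notin U ->
  exists a : {scalar g}, a e = 1 /\ forall u, u \in U -> a u = 0.
Proof.
move=> eU; have e0 : e != 0 by apply: contraNneq eU => ->; rewrite mem0v.
have dUe := cap_line_notin eU.
have fe : free [tuple e] by rewrite seq1_free.
exists (coord [tuple e] ord0 \o daddv_pi <[e]> U : {scalar g}); split=> /=.
  rewrite daddv_pi_id ?memv_line //.
  by rewrite -[X in coord _ _ X]/([tuple e]`_(ord0 : 'I_1)) coord_free.
move=> u uU; have := daddv_pi_add dUe (subvP (addvSr <[e]> U) _ uU).
rewrite [daddv_pi U _ u]daddv_pi_id ?(capvC U) // => /eqP.
by rewrite -subr_eq0 addrK => /eqP->; rewrite linear0.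
Qed.

(** * The product attached to a complement of the derived algebra *)

Lemma bracket_antisym (k : fieldType) (g : lmodType k)
    (br : {bilinear g -> g -> g}) :
  is_lie_bracket br -> forall x y, br x y = - br y x.
Proof.
case=> alt _ x y; apply/eqP; rewrite -addr_eq0; apply/eqP.
by have := alt (x + y); rewrite linearDl !linearDr /= !alt add0r addr0.
Qed.

(** In the Jacobi identity for x, y, v the term [v, [x, y]] vanishes: both of
    its arguments lie in the abelian ideal D. *)
Lemma adjoint_commute (k : fieldType) (g : vectType k)
    (br : {bilinear g -> g -> g}) (D : {vspace g}) :
  is_lie_bracket br ->
  (forall x y, br x y \in D) ->
  (forall u v, u \in D -> v \in D -> br u v = 0) ->
  forall x y v, v \in D -> br x (br y v) = br y (br x v).
Proof.
move=> lie brD DD x y v vD.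
have := lie.2 x y v; rewrite [br v (br x y)]DD // addr0.
by rewrite [br v x](bracket_antisym lie) linearN => /eqP; rewrite subr_eq0 => /eqP.
Qed.

(** The vector r y is the component of y in the abelian ideal D, along the
    span of e1 and e2.  The formula for the product is retained in the
    conclusion because completeness is read off from it. *)
Lemma LR_product (k : fieldType) (g : vectType k)
    (br : {bilinear g -> g -> g}) (D : {vspace g}) (a b : {scalar g})
    (e1 e2 z : g) (r := fun y => y - a y *: e1 - b y *: e2) :
  is_lie_bracket br ->
  (forall x y, br x y \in D) ->
  (forall u v, u \in D -> v \in D -> br u v = 0) ->
  (forall u, u \in D -> a u = 0 /\ b u = 0) ->
  (forall y, r y \in D) ->
  z \in D ->
  br e1 z = br e2 (br e1 e2) ->
  exists mul : {bilinear g -> g -> g}, is_LR_structure br mul /\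
    forall x y,
      mul x y = br x (r y) + (a x * b y) *: br e1 e2 + (b x * b y) *: z.
Proof.
move=> lie brD DD abD rD zD zE; set c := br e1 e2.
have brC := bracket_antisym lie.
have adC := adjoint_commute lie brD DD.
have r_lin s u v : r (s *: u + v) = s *: r u + r v.
  rewrite /r !linearP /= !scalerDl !scalerBr !scalerA !opprD.
  by rewrite (AC (2*2*2) ((1*3*5)*(2*4*6))).
have r_dec y : y = r y + a y *: e1 + b y *: e2.
  by rewrite /r addrAC subrK subrK.
have rid u : u \in D -> r u = u.
  by move=> /abD[au bu]; rewrite /r au bu !scale0r !subr0.
(* With r opaque, additivity of the bracket does not expand r x below. *)
clearbody r.
pose m x y := br x (r y) + (a x * b y) *: c + (b x * b y) *: z.
have m_bil : bilinear_for *:%R *:%R m.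
  split=> [y | x] s u v; rewrite /m.
    rewrite linearPl !linearP /= !mulrDl !scalerDl !scalerDr !scalerA !mulrA.
    by rewrite (AC (2*2*2) ((1*3*5)*(2*4*6))).
  rewrite r_lin linearPr !linearP /= !mulrDr !scalerDl !scalerDr !scalerA.
  rewrite !(mulrCA _ s) !mulrA.
  by rewrite (AC (2*2*2) ((1*3*5)*(2*4*6))).
have [mul mulE] := bilinear_of m_bil.
have mulD x y : mul x y \in D by rewrite mulE /m !rpredD ?rpredZ ?brD.
have mulDl u y : u \in D -> mul u y = 0.
  move=> uD; have [au bu] := abD _ uD.
  by rewrite mulE /m au bu !mul0r !scale0r !addr0 DD.
have mulDr x u : u \in D -> mul x u = br x u.
  move=> uD; have [au bu] := abD _ uD.
  by rewrite mulE /m bu !mulr0 !scale0r !addr0 rid.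
have brDl x u : u \in D -> br x u = a x *: br e1 u + b x *: br e2 u.
  move=> uD; rewrite {1}(r_dec x) !linearDl /= (DD _ _ (rD x) uD) add0r.
  by rewrite !linearZl_LR.
exists mul; split; last by move=> x y; rewrite mulE.
split=> [x y w | x y w | x y].
- rewrite !(mulDr _ _ (mulD _ _)) !mulE /m !linearDr /= !linearZr_LR /=.
  (* What remains is symmetric in x and y once [e1, z] is replaced by [e2, c]. *)
  rewrite adC // -!addrA; congr (_ + _).
  rewrite (brDl x c) ?(brDl y c) ?(brDl x z) ?(brDl y z) ?brD //.
  rewrite zE -/c !scalerDr !scalerA.
  rewrite addrACA !(mulrAC _ (b w)) (mulrC (a y) (a x)) (mulrC (b y) (a x)).
  by rewrite (mulrC (a y) (b x)) (mulrC (b y) (b x)).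
- by rewrite !(mulDl _ _ (mulD _ _)).
rewrite !mulE /m.
have bre1 : br x e1 = br (r x) e1 - b x *: c.
  rewrite {1}(r_dec x) !linearDl !linearZl_LR /= lie.1 scaler0 addr0.
  by rewrite [br e2 e1]brC scalerN.
have bre2 : br x e2 = br (r x) e2 + a x *: c.
  by rewrite {1}(r_dec x) !linearDl !linearZl_LR /= lie.1 scaler0 addr0.
have brry : br y (r x) = - (a y *: br (r x) e1 + b y *: br (r x) e2).
  by rewrite brC {1}(r_dec y) !linearDr !linearZr_LR /= (DD _ _ (rD x) (rD y)) add0r.
rewrite {1}(r_dec y) !linearDr !linearZr_LR /= bre1 bre2 brry.
rewrite !scalerDr scalerN !scalerA !opprD !opprK.
rewrite (mulrC (b y) (b x)) (mulrC (b y) (a x)).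
by rewrite [RHS](AC (3*4) ((3*7)*((1*(4*6))*(5*2)))) /= subrr add0r.
Qed.

(** * The lower central series of a nilpotent algebra *)

Lemma lower_central_step (k : fieldType) (g : vectType k)
    (br : {bilinear g -> g -> g}) i x y :
  y \in lower_central br i -> br x y \in lower_central br i.+1.
Proof. by apply: (brv_subP br fullv _ _).2; rewrite ?memvf. Qed.

Lemma bracket_in_derived (k : fieldType) (g : vectType k)
    (br : {bilinear g -> g -> g}) x y :
  br x y \in lower_central br 1.
Proof. exact: (lower_central_step (i := 0) x (memvf y)). Qed.

Lemma lower_central_succ_sub (k : fieldType) (g : vectType k)
    (br : {bilinear g -> g -> g}) i :
  (lower_central br i.+1 <= lower_central br i)%VS.
Proof.
elim: i => [|i IHi]; first exact: subvf.
apply/brv_subP=> x y _ yC; exact: lower_central_step (subvP IHi _ yC).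
Qed.

Lemma lower_central_stationary (k : fieldType) (g : vectType k)
    (br : {bilinear g -> g -> g}) i m :
  (lower_central br i <= lower_central br i.+1)%VS ->
  (lower_central br i <= lower_central br (i + m))%VS.
Proof.
move=> stat; elim: m => [|m IHm]; first by rewrite addn0.
apply: subv_trans stat _; rewrite addnS.
by apply/brv_subP=> x y _ yC; apply: lower_central_step (subvP IHm _ yC).
Qed.

Lemma lower_central_dim_strict (k : fieldType) (g : vectType k)
    (br : {bilinear g -> g -> g}) c i :
  nilpotent_of_class br c -> (i < c)%N ->
  (\dim (lower_central br i.+1) < \dim (lower_central br i))%N.
Proof.
case=> Cc0 Cn0 ic.
rewrite (ltn_leqif (dimv_leqif_sup (lower_central_succ_sub br i))).
apply/negP=> /(lower_central_stationary (c - i)).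
by rewrite subnKC 1?ltnW // Cc0 subv0 => /eqP/(Cn0 _ ic).
Qed.

(** The series drops by at least one at each of the steps that remain before it
    vanishes. *)
Lemma lower_central_dim_ge (k : fieldType) (g : vectType k)
    (br : {bilinear g -> g -> g}) c i :
  nilpotent_of_class br c -> (c - i <= \dim (lower_central br i))%N.
Proof.
move=> nil_c; move def_m: (c - i)%N => m.
elim: m i def_m => [|m IHm] j jm //.
have jc : (j < c)%N by rewrite -subn_gt0 jm.
apply: leq_trans (lower_central_dim_strict nil_c jc).
by rewrite ltnS IHm // subnS jm.
Qed.

(** If g were spanned by C_1 and one vector e, then [e, e] = 0 would put every
    bracket into [g, C_1] = C_2, and the series would be stationary at C_1. *)
Lemma lower_central_dim_abelianization (k : fieldType) (g : vectType k)
    (br : {bilinear g -> g -> g}) c :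
  is_lie_bracket br -> nilpotent_of_class br c -> (1 < c)%N ->
  (\dim (lower_central br 1) + 2 <= \dim {:g})%N.
Proof.
move=> lie nil_c c1.
have lt10 := lower_central_dim_strict nil_c (ltnW c1).
have : ~~ ({:g} <= lower_central br 1)%VS.
  by rewrite -(ltn_leqif (dimv_leqif_sup (subvf _))).
case/subvPn=> e _ eC; rewrite addn2 leqNgt; apply/negP=> dim_lt.
have full : (lower_central br 1 + <[e]>)%VS = fullv.
  apply/eqP; rewrite -(dimv_leqif_eq (subvf _)) dim_add_line // eqn_leq.
  by rewrite lt10 -ltnS.
have := lower_central_dim_strict nil_c c1.
rewrite ltnNge => /negP[]; apply: dimvS; apply/brv_subP=> x y _ _.
have := memvf x; rewrite -full => /memv_addP[u uC [_ /vlineP[s ->] ->]].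
have := memvf y; rewrite -full => /memv_addP[v vC [_ /vlineP[t ->] ->]].
rewrite linearDr linearZr_LR [br (u + _) e]linearDl linearZl_LR lie.1.
rewrite scaler0 addr0 (bracket_antisym lie u e) rpredD ?rpredZ ?rpredN //.
  exact: lower_central_step vC.
exact: lower_central_step uC.
Qed.

(** Bracketing C_i <= D + C_(i+1) with g and using that D is an ideal gives
    C_j <= D + C_(j+1) for all j >= i; chaining these inclusions ends in
    D + 0. *)
Lemma lower_central_nakayama (k : fieldType) (g : vectType k)
    (br : {bilinear g -> g -> g}) (D : {vspace g}) c i :
  lower_central br c = 0%VS ->
  (forall x y, y \in D -> br x y \in D) ->
  (lower_central br i <= D + lower_central br i.+1)%VS ->
  (lower_central br i <= D)%VS.
Proof.
move=> Cc0 idealD subC.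
have step m : (lower_central br (m + i) <= D + lower_central br (m + i).+1)%VS.
  elim: m => [|m IHm] //; apply/brv_subP=> x y _ yC.
  have /memv_addP[u uD [v vC ->]] := subvP IHm _ yC.
  by rewrite linearDr memv_add ?idealD ?lower_central_step.
have low m : (lower_central br i <= D + lower_central br (m + i))%VS.
  elim: m => [|m IHm]; first exact: addvSr.
  by apply: subv_trans IHm _; rewrite subv_add addvSl step.
have Cci : lower_central br (c + i) = 0%VS.
  elim: {step low subC} i => [|i IHi]; first by rewrite addn0.
  by rewrite addnS; apply/eqP; rewrite -subv0 -IHi lower_central_succ_sub.
by have := low c; rewrite Cci addv0.
Qed.

(** * Filiform algebras *)

Lemma brv_not_subP (k : fieldType) (g : vectType k)
    (br : {bilinear g -> g -> g}) (U W X : {vspace g}) :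
  ~~ (brv br U W <= X)%VS ->
  exists u w, [/\ u \in U, w \in W & br u w \notin X].
Proof.
move=> not_sub.
have /allPn[_ /allpairsP[[u w] [/= uU wW ->]] uwX] :
    ~~ all [in X] [seq br u w | u <- vbasis U, w <- vbasis W].
  by apply: contra not_sub => /allP sub; apply/span_subvP.
by exists u, w; split=> //; apply: vbasis_mem.
Qed.

(** The dimension of g forces C_2 / C_3 to be at most a line, so [e, C_1]
    fills it as soon as it is not contained in C_3.  Since C_1 is abelian,
    [e, C_1] is an ideal: [x, [e, u]] = [e, [x, u]] for u in C_1. *)
Lemma filiform_generator (k : fieldType) (g : vectType k)
    (br : {bilinear g -> g -> g}) c :
  is_lie_bracket br -> nilpotent_of_class br c -> (1 < c)%N ->
  \dim {:g} = c.+1 ->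
  (forall u v, u \in lower_central br 1 -> v \in lower_central br 1 ->
     br u v = 0) ->
  exists2 e, e \notin lower_central br 1 &
    (lower_central br 2 <= linfun (br e) @: lower_central br 1)%VS.
Proof.
move=> lie nil_c c1 dimg C1C1.
have dim1 := lower_central_dim_abelianization lie nil_c c1.
have [c2|c2] := leqP c 2.
  have ec : c = 2%N by apply/eqP; rewrite eqn_leq c2.
  have : ~~ ({:g} <= lower_central br 1)%VS.
    rewrite -(ltn_leqif (dimv_leqif_sup (subvf _))).
    exact: lower_central_dim_strict nil_c (ltnW c1).
  case/subvPn=> e _ eC; exists e => //.
  by rewrite -ec nil_c.1 sub0v.
have [e [v [vC1 evC3]]] : exists e v, v \in lower_central br 1 /\
    br e v \notin lower_central br 3.
  have: ~~ (lower_central br 2 <= lower_central br 3)%VS.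
    rewrite -(ltn_leqif (dimv_leqif_sup (lower_central_succ_sub br 2))).
    exact: lower_central_dim_strict nil_c c2.
  by case/brv_not_subP=> e [v [_ vC ?]]; exists e, v.
(* If e were in C_1, then [e, v] = 0 would lie in C_3. *)
exists e; first by apply: contra evC3 => eC1; rewrite C1C1 ?mem0v.
apply: lower_central_nakayama nil_c.1 _ _.
  move=> x _ /memv_imgP[u uC1 ->]; rewrite lfunE /=.
  rewrite (adjoint_commute lie (bracket_in_derived br) C1C1) //.
  rewrite -[br e _]lfunE memv_img //.
  exact: subvP (lower_central_succ_sub br 1) _ (lower_central_step x uC1).
have evC2 := lower_central_step e vC1.
have C3e : (lower_central br 3 + <[br e v]> = lower_central br 2)%VS.
  apply/eqP; rewrite -(dimv_leqif_eq _); last first.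
    by rewrite subv_add lower_central_succ_sub -memvE.
  (* dim C_1 <= c - 1 gives dim C_2 <= c - 2, while dim C_3 >= c - 3. *)
  have dim2 := lower_central_dim_strict nil_c c1.
  have dim3 := lower_central_dim_ge 3 nil_c.
  have dim32 := lower_central_dim_strict nil_c c2.
  rewrite dim_add_line // eqn_leq dim32 andTb.
  rewrite dimg in dim1.
  lia.
rewrite -C3e subv_add addvSr -memvE.
apply: subvP (addvSl _ _) _ _.
by rewrite -[br e v]lfunE memv_img.
Qed.

Theorem proposition4p2 (k : fieldType) (n : nat) (f : vectType k)
    (br : {bilinear f -> f -> f}) :
  [pchar k] =i pred0 ->
  is_lie_bracket br ->
  is_filiform br n ->
  two_step_solvable br ->
  exists mul : {bilinear f -> f -> f},
    is_LR_structure br mul /\ is_complete mul.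
Proof.
move=> _ lie []; case: n => // c _ dimf; rewrite -pred_Sn => nil_c solv.
have metab u v : u \in lower_central br 1 -> v \in lower_central br 1 ->
    br u v = 0.
  move=> uC vC; apply/eqP; rewrite -memv0 -solv.
  exact: ((brv_subP br _ _ _).2 (subvv _)).
have brC1 := bracket_in_derived br.
(* In class at most one all brackets vanish, and so does the product. *)
have [c_le1|c_gt1] := leqP c 1.
  have br0 x y : br x y = 0.
    apply/eqP; rewrite -memv0 -nil_c.1.
    by case: c c_le1 {dimf nil_c} => [|[|]] // _; rewrite ?memvf.
  exists br; split; last by move=> x; exists 1%N => y /=.
  by split=> [x y z|x y z|x y]; rewrite !br0 ?subr0.
have [e1 e1C gen] := filiform_generator lie nil_c c_gt1 dimf metab.
set C1 := lower_central br 1 in metab brC1 e1C gen *.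
have dimC1 : \dim C1 = c.-1.
  have := lower_central_dim_abelianization lie nil_c c_gt1.
  have := lower_central_dim_ge 1 nil_c.
  rewrite dimf subn1 addn2 !ltnS => ge1 le1; apply/eqP; rewrite eqn_leq ge1.
  by rewrite andbT -ltnS prednK // ltnW.
have dimCe : \dim (C1 + <[e1]>) = c by rewrite dim_add_line // dimC1 prednK // ltnW.
have : ~~ ({:f} <= C1 + <[e1]>)%VS.
  by rewrite -(ltn_leqif (dimv_leqif_sup (subvf _))) dimCe dimf.
case/subvPn=> e2 _ e2C.
have full : (C1 + <[e1]> + <[e2]>)%VS = fullv.
  by apply/eqP; rewrite -(dimv_leqif_eq (subvf _)) dim_add_line // dimCe dimf.
have e1C2 : e1 \notin (C1 + <[e2]>)%VS.
  apply: contra e2C => /memv_addP[u uC [_ /vlineP[s ->] e1E]].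
  have [s0|s0] := eqVneq s 0.
    by case/negP: e1C; rewrite e1E s0 scale0r addr0.
  have -> : e2 = s^-1 *: (- u + e1).
    by rewrite e1E addKr scalerA mulVf ?scale1r.
  by rewrite memvZ // memv_add ?rpredN ?memv_line //.
have [a [ae1 aC]] := separating_functional e1C2.
have [b [be2 bC]] := separating_functional e2C.
have /memv_imgP[z zC1 zE] : br e2 (br e1 e2) \in (linfun (br e1) @: C1)%VS.
  by apply: subvP gen _ _; do 2!apply: lower_central_step; rewrite memvf.
rewrite lfunE /= in zE.
have abC1 u : u \in C1 -> a u = 0 /\ b u = 0.
  by move=> uC; rewrite aC ?bC // (subvP (addvSl _ _)).
have resC1 y : y - a y *: e1 - b y *: e2 \in C1.
  have := memvf y; rewrite -full.
  case/memv_addP=> _ /memv_addP[u uC [_ /vlineP[s ->] ->]] [_ /vlineP[t ->] ->].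
  have [au bu] := abC1 u uC.
  rewrite !linearD /= !linearZ /= au bu ae1 be2.
  rewrite aC ?bC ?memv_line ?(subvP (addvSr _ _)) ?memv_line //.
  by rewrite !mulr0 !mulr1 !add0r !addr0 !scalerN addrAC addrK addrK.
have [mul [LR mulE]] :=
  LR_product lie brC1 metab abC1 resC1 zC1 (esym zE).
exists mul; split=> // x; exists c.+1 => y.
(* The first product lands in C_1, where x acts as ad x, so that every further
   one moves a step down the lower central series. *)
suff low m : iter m (mul x) y \in lower_central br m.
  apply/eqP; rewrite -memv0 -nil_c.1.
  exact: subvP (lower_central_succ_sub br c) _ (low c.+1).
elim: m => [|[|m] IHm]; first exact: memvf.
  by rewrite /= mulE !rpredD ?rpredZ ?brC1.
rewrite iterS mulE.
have uC1 : iter m.+1 (mul x) y \in C1.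
  by rewrite /= mulE !rpredD ?rpredZ ?brC1.
have [-> ->] := abC1 _ uC1.
by rewrite !mulr0 !scale0r !addr0 !subr0 lower_central_step.
Qed.
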